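(* Euler's totient function $\varphi(n)$ (for integer arguments $n\ge2$) can be represented by the arithmetic term $$\mathrm{HW}(M(n))/(n+5)-(n+1)^3,$$ i.e. $\varphi(n)$ equals this expression for every integer $n\ge2$, where $$\begin{aligned}M(n)={}&\mathcal C(1,3)+\mathcal A(x_1^2x_2^2,3)+\mathcal A(n^2x_3^2,3)\\&+\mathcal A(-2nx_1x_2x_3,3)+\mathcal A(-2x_1x_2,3)+\mathcal A(2nx_3,3),\end{aligned}$$ with $\mathcal C$ and $\mathcal A$ formed with the parameters $t=n+1$ and $w=n+5$.
   Context: $\varphi(n)$ is the number of positive integers not exceeding $n$ that are coprime with $n$. $\mathrm{HW}(N)$ is the Hamming weight of $N$ (number of ones in its binary representation). $G_r(q,s)=\sum_{j=0}^{s}j^rq^j$ with $0^0=1$; for each fixed $r$ this has a closed form. Given parameters $t>1$, $w$ (depending on the arguments) and $k\ge1$: $$\mathcal C(\varepsilon,k)=(2^w-\varepsilon+1)\,\frac{2^{2wt^k}-1}{2^w+1},$$ and for a monomial $\mu=\alpha\, b_1^{\beta_1x_1}\cdots b_k^{\beta_kx_k}x_1^{\gamma_1}\cdots x_k^{\gamma_k}$ in the formal variables $x_1,\dots,x_k$ (with $\alpha$ an integer possibly negative, and absent exponential factors meaning $\beta_i=0$, absent powers meaning $\gamma_i=0$), $$\mathcal A(\mu,k)=-(2^w-1)\,\alpha\prod_{i=1}^kG_{\gamma_i}\!\left(2^{2wt^{i-1}}b_i^{\beta_i},\,t-1\right).$$ An arithmetic term is an expression built from natural-number constants and the variables by the operations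 $x+y$, $\max(x-y,0)$, $\lfloor x/y\rfloor$, $x^y$ (with $0^0=1$, $\lfloor x/0\rfloor=0$). Products, $\mathrm{HW}$ and $G_r$ (fixed $r$) are expressible by arithmetic terms and are used as abbreviations; formulas are written with ordinary subtraction and exact division for readability. *)

(* Defs.v *)
From mathcomp Require Import all_boot all_order all_algebra.

Set Implicit Arguments.
Unset Strict Implicit.
Unset Printing Implicit Defensive.

Import Order.TTheory GRing.Theory Num.Theory.

(* Terms in k variables.  In [eval_aterm] the ssrnat conventions are those
   required: truncated subtraction, x %/ 0 = 0 and 0 ^ 0 = 1. *)
Inductive aterm (k : nat) : Type :=
| AVar of 'I_k
| ACst of nat
| AAdd of aterm k & aterm k
| ASub of aterm k & aterm k
| ADiv of aterm k & aterm k
| APow of aterm k & aterm k.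

Fixpoint eval_aterm k (v : 'I_k -> nat) (T : aterm k) : nat :=
  match T with
  | AVar i => v i
  | ACst c => c
  | AAdd T1 T2 => eval_aterm v T1 + eval_aterm v T2
  | ASub T1 T2 => eval_aterm v T1 - eval_aterm v T2
  | ADiv T1 T2 => eval_aterm v T1 %/ eval_aterm v T2
  | APow T1 T2 => eval_aterm v T1 ^ eval_aterm v T2
  end.

(* The i-th binary digit of N is the parity of N %/ 2 ^ i; all the digits of
   rank >= N vanish since N < 2 ^ N. *)
Definition HW (N : nat) : nat := \sum_(0 <= i < N) odd (N %/ 2 ^ i).

Definition G (r q s : nat) : nat := \sum_(0 <= j < s.+1) j ^ r * q ^ j.

(* The formal monomial
     alpha b_1^(beta_1 x_1) ... b_k^(beta_k x_k) x_1^gamma_1 ... x_k^gamma_k;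
   component i : 'I_k of a tuple is the parameter of index i + 1. *)
Record monomial (k : nat) := Monomial {
  mon_coef : int;
  mon_base : k.-tuple nat;
  mon_rate : k.-tuple nat;
  mon_expo : k.-tuple nat
}.

(* alpha x_1^gamma_1 ... x_k^gamma_k: without exponential factors, the bases
   are irrelevant. *)
Definition pow_monomial k (alpha : int) (gamma : k.-tuple nat) : monomial k :=
  Monomial alpha [tuple of nseq k 1] [tuple of nseq k 0] gamma.

Section HypercubeTerms.
Local Open Scope ring_scope.

(* The integer division is exact: 2^w + 1 divides 2^(2w) - 1. *)
Definition Cterm (t w : nat) (eps : int) (k : nat) : int :=
  (2 ^+ w - eps + 1) * ((2 ^+ (2 * w * t ^ k)%N - 1) %/ (2 ^+ w + 1))%Z.

(* i : 'I_k counts from 0, so that t ^ i is t^(i-1) for indices from 1. *)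
Definition Aterm (t w k : nat) (mu : monomial k) : int :=
  - (2 ^+ w - 1) * mon_coef mu *
  \prod_(i < k)
    (G (tnth (mon_expo mu) i)
       (2 ^ (2 * w * t ^ i) * tnth (mon_base mu) i ^ tnth (mon_rate mu) i)%N
       (t - 1)%N)%:Z.

Definition M (n : nat) : int :=
  let t := (n + 1)%N in
  let w := (n + 5)%N in
  Cterm t w 1 3
  + Aterm t w (pow_monomial 1 [tuple 2; 2; 0]%N)
  + Aterm t w (pow_monomial (n%:Z ^+ 2) [tuple 0; 0; 2]%N)
  + Aterm t w (pow_monomial (- 2 * n%:Z) [tuple 1; 1; 1]%N)
  + Aterm t w (pow_monomial (- 2) [tuple 1; 1; 0]%N)
  + Aterm t w (pow_monomial (2 * n%:Z) [tuple 0; 0; 1]%N).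

End HypercubeTerms.

(* Main.v *)
Require Import Defs.
From mathcomp Require Import all_boot all_order all_algebra.
From mathcomp Require Import zify ring.

(** The five monomials of [M n], together with a constant 1, add up to
    f(x, y, z) = (x y - n z - 1)^2.  Put w = n + 5 and t = n + 1, and run
    (x, y, z) over the cube {0, ..., n}^3.  Summing geometric progressions shows
    that, in base 2^(2w), the digit of [M n] at rank x + t y + t^2 z is
    (2^w - 1) (2^w + 1 - f(x, y, z)), a legitimate digit because
    f <= (n^2 + 1)^2 <= 2^w.  If f = 0, this digit is 2^(2w) - 1 and has 2w ones.
    If f > 0, it is (2^w - 1) m with 0 < m <= 2^w, and such a product has
    exactly w ones, since its lower half is the bitwise complement of its upper
    half m - 1.  Hence HW (M n) = w (t^3 + Z), where Z counts the zeros of f in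
    the cube ([HW_M]).  A zero is a residue x with an inverse y modulo n, z being
    then the quotient of x y by n; as x determines y and z, Z is the number of
    units modulo n, that is, the totient ([totient_count]).

    It remains to express the formula by a term.  Multiplication comes from
    (a + b)^2 - a^2 - b^2 = 2 a b, and the sums G_0, G_1, G_2 from telescoping.
    The Hamming weight of N is the 2-adic valuation of the central binomial
    coefficient 'C(2N, N), by Legendre's formula ([HW_central_binomial]).  Binomial
    coefficients and greatest common divisors are digits, in a large base, of
    quantities that have a closed form ([binomial_digit], [gcd_digit]): the former
    are coefficients of (X + 1)^m, the latter count the solutions of
    a i + b j = a b.  Finally 2^v = gcd(m, 2^m) yields v, the valuation of m, by
    expanding (1 + Y)^v modulo Y^2 with Y = 2^(m+1) - 1 ([log_two_part]). *)

Set Implicit Arguments.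
Unset Strict Implicit.
Unset Printing Implicit Defensive.
Import GRing.Theory Num.Theory.

(** * Hamming weight *)

(** Digits beyond the length of N vanish, so the number of digits inspected is
    free; this is what makes the weights of different numbers comparable. *)
Lemma HW_widen K N : N < 2 ^ K -> HW N = \sum_(i < K) odd (N %/ 2 ^ i).
Proof.
have widen L d : N < 2 ^ L ->
    \sum_(i < L + d) odd (N %/ 2 ^ i) = \sum_(i < L) odd (N %/ 2 ^ i).
  move=> NL; rewrite big_split_ord /= [X in _ + X]big1 ?addn0 // => i _.
  by rewrite divn_small // (leq_trans NL) // leq_exp2l ?leq_addr.
move=> NK; transitivity (\sum_(i < N + K) odd (N %/ 2 ^ i)).
  by rewrite /HW big_mkord; apply/esym/widen/ltn_expl.
by rewrite (addnC N K); apply: widen.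
Qed.

Lemma HW0 : HW 0 = 0. Proof. by rewrite /HW big_geq. Qed.

Lemma HW1 : HW 1 = 1. Proof. by rewrite /HW big_nat1. Qed.

(** The binary expansions of a and b are juxtaposed without carry. *)
Lemma HW_concat W a b : a < 2 ^ W -> HW (a + b * 2 ^ W) = HW a + HW b.
Proof.
move=> aW.
have bb : b < 2 ^ b by apply: ltn_expl.
rewrite (@HW_widen (W + b)); last first.
  rewrite expnD; apply: (@leq_trans (b.+1 * 2 ^ W)).
    by rewrite mulSn ltn_add2r.
  by rewrite mulnC leq_mul2l bb orbT.
rewrite big_split_ord /= (HW_widen aW) (HW_widen bb).
congr (_ + _); apply: eq_bigr => i _.
  have iW := ltn_ord i.
  have -> : 2 ^ W = 2 ^ (W - i) * 2 ^ i by rewrite -expnD subnK // ltnW.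
  rewrite mulnA addnC divnMDl ?expn_gt0 //.
  by rewrite oddD oddM oddX subn_eq0 leqNgt iW andbF addFb.
by rewrite expnD divnMA [a + _]addnC divnMDl ?expn_gt0 // (divn_small aW) addn0.
Qed.

(** Subtracting from 2^w - 1 flips each of the w bits. *)
Lemma HW_compl w x : x < 2 ^ w -> HW x + HW (2 ^ w - 1 - x) = w.
Proof.
elim: w x => [|w IHw] x.
  by rewrite expn0; case: x => // _; rewrite HW0.
rewrite expnS => xw.
have xE : x = x %% 2 + x %/ 2 * 2 ^ 1 by rewrite expn1 addnC -divn_eq.
have x2w : x %/ 2 < 2 ^ w by rewrite ltn_divLR // mulnC.
have x2 : x %% 2 < 2 by rewrite ltn_mod.
have -> : 2 * 2 ^ w - 1 - x = (1 - x %% 2) + (2 ^ w - 1 - x %/ 2) * 2 ^ 1.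
  by lia.
rewrite {1}xE !HW_concat //; last by rewrite expn1; lia.
rewrite addnACA IHw //.
by case: (x %% 2) x2 => [|[|]] //; rewrite ?subn0 ?subnn HW0 HW1.
Qed.

Lemma HW_mersenne w : HW (2 ^ w - 1) = w.
Proof.
have := @HW_compl w 0; rewrite subn0 HW0 add0n; apply.
by rewrite expn_gt0.
Qed.

(** (2^w - 1) m = (m - 1) 2^w + (2^w - 1 - (m - 1)): the upper half is m - 1, the
    lower half its complement. *)
Lemma HW_mersenne_mul w m : 0 < m <= 2 ^ w -> HW ((2 ^ w - 1) * m) = w.
Proof.
move=> /andP[m0 mw].
have -> : (2 ^ w - 1) * m = (2 ^ w - 1 - (m - 1)) + (m - 1) * 2 ^ w.
  by nia.
rewrite HW_concat; last by lia.
by rewrite addnC HW_compl //; lia.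
Qed.

Lemma digits_bound W t (d : nat -> nat) :
  (forall i, i < t -> d i < 2 ^ W) ->
  \sum_(i < t) d i * 2 ^ (W * i) < 2 ^ (W * t).
Proof.
elim: t => [|t IHt] dW; first by rewrite big_ord0 expn_gt0.
rewrite big_ord_recr /= mulnS expnD.
apply: (@leq_trans ((d t).+1 * 2 ^ (W * t))); last by rewrite leq_mul2r dW ?orbT.
by rewrite mulSn ltn_add2r; apply: IHt => i it; apply/dW/ltnW.
Qed.

Lemma HW_digits W t (d : nat -> nat) :
  (forall i, i < t -> d i < 2 ^ W) ->
  HW (\sum_(i < t) d i * 2 ^ (W * i)) = \sum_(i < t) HW (d i).
Proof.
elim: t => [|t IHt] dW; first by rewrite !big_ord0 HW0.
have dW' i : i < t -> d i < 2 ^ W by move=> it; apply/dW/ltnW.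
by rewrite !big_ord_recr /= HW_concat ?IHt //; apply: digits_bound.
Qed.

(** Legendre's formula gives N %/ 2^k - 2 (N %/ 2^(k+1)) as the contribution of
    each k to the valuation, and this is the digit of rank k of N. *)
Lemma HW_central_binomial N : HW N = logn 2 'C(2 * N, N).
Proof.
have legendre m K : m <= K -> logn 2 m`! = \sum_(k < K) m %/ 2 ^ k.+1.
  move=> mK; rewrite logn_fact // big_add1 /= big_mkord.
  rewrite -(subnKC mK) big_split_ord /= [X in _ = _ + X]big1 ?addn0 // => i _.
  rewrite divn_small // (leq_ltn_trans (leq_addr i m)) //.
  by rewrite (ltn_trans (ltnSn _)) // ltn_expl.
have NN : N <= 2 * N by rewrite leq_pmull.
have := congr1 (logn 2) (bin_fact NN).
rewrite mul2n -addnn addnK !lognM ?muln_gt0 ?fact_gt0 ?bin_gt0 ?leq_addr //.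
rewrite !(legendre _ (N + N)) ?leq_addr // (@HW_widen (N + N)); last first.
  by rewrite (leq_trans (ltn_expl N (ltnSn 1))) // leq_exp2l ?leq_addr.
suff -> : \sum_(k < N + N) (N + N) %/ 2 ^ k.+1 =
    \sum_(k < N + N) odd (N %/ 2 ^ k) +
      (\sum_(k < N + N) N %/ 2 ^ k.+1 + \sum_(k < N + N) N %/ 2 ^ k.+1).
  by move/addIn.
rewrite -!big_split; apply: eq_bigr => k _ /=.
move: (nat_of_ord k) => j.
have -> : (N + N) %/ 2 ^ j.+1 = N %/ 2 ^ j by rewrite addnn -mul2n expnS divnMl.
by rewrite expnSr divnMA divn2 addnn odd_double_half.
Qed.

(** * Reading a digit: binomial coefficients, gcd, valuations *)

(** The coefficients of the generating polynomial sum to less than X, so no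
    carry occurs when it is evaluated at X: the terms of exponent below k add up
    to less than X^k, and those above k are multiples of X^(k+1). *)
Lemma digit_extraction (I : finType) (c e : I -> nat) X k :
  \sum_i c i < X ->
  (\sum_i c i * X ^ e i) %/ X ^ k %% X = \sum_(i | e i == k) c i.
Proof.
move=> cX; have X0 : 0 < X by apply: leq_ltn_trans cX.
have Xk0 : 0 < X ^ k by rewrite expn_gt0 X0.
rewrite (bigID (fun i => e i < k)) /=.
set lo := \sum_(i | e i < k) _.
have lo_small : lo < X ^ k.
  rewrite -(ltn_pmul2r X0) [X in _ < X]mulnC.
  apply: (@leq_ltn_trans ((\sum_i c i) * X ^ k)); last by rewrite ltn_pmul2r.
  rewrite big_distrl big_distrl /= [X in _ <= X](bigID (fun i => e i < k)) /=.
  apply: leq_trans (leq_addr _ _); apply: leq_sum => i eik.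
  by rewrite -mulnA leq_mul2l -expnSr leq_pexp2l ?orbT.
rewrite (bigID (fun i => e i == k)) /=.
have -> : \sum_(i | ~~ (e i < k) && (e i == k)) c i * X ^ e i =
    (\sum_(i | e i == k) c i) * X ^ k.
  rewrite big_distrl /=; apply: eq_big => [i|i /andP[_ /eqP-> //]].
  by case: eqVneq => [->|]; rewrite ?ltnn ?andbF.
have -> : \sum_(i | ~~ (e i < k) && (e i != k)) c i * X ^ e i =
    (\sum_(i | k < e i) c i * X ^ (e i - k.+1)) * X * X ^ k.
  rewrite -mulnA -expnS big_distrl /=; apply: eq_big => [i|i /andP[ek ek']].
    by rewrite -leqNgt ltn_neqAle eq_sym andbC.
  by rewrite -mulnA -expnD subnK // ltn_neqAle eq_sym ek' leqNgt.
rewrite -mulnDl addnC divnMDl // (divn_small lo_small) addn0.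
rewrite addnC modnMDl modn_small //; apply: leq_ltn_trans cX.
by rewrite [X in _ <= X](bigID (fun i => e i == k)) /= leq_addr.
Qed.

(** The base must exceed the sum of all the coefficients of (X + 1)^m, which is
    2^m; hence the choice X = 2^(m+1). *)
Lemma binomial_digit m k : k <= m ->
  (2 ^ m.+1 + 1) ^ m %/ (2 ^ m.+1) ^ k %% 2 ^ m.+1 = 'C(m, k).
Proof.
move=> km; rewrite addn1 -addn1 addnC expnDn.
have -> : \sum_(i < m.+1) 'C(m, i) * (1 ^ (m - i) * (2 ^ m.+1) ^ i) =
    \sum_(i < m.+1) 'C(m, i) * (2 ^ m.+1) ^ i.
  by apply: eq_bigr => i _; rewrite exp1n mul1n.
rewrite digit_extraction; last first.
  have -> : \sum_(i < m.+1) 'C(m, i) = 2 ^ m.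
    rewrite (expnDn 1 1 m); apply: eq_bigr => i _.
    by rewrite !exp1n !muln1.
  by rewrite ltn_exp2l.
have km' : k < m.+1 by [].
by rewrite (big_pred1 (Ordinal km')).
Qed.

Lemma sum_indicator_unique m (P : nat -> bool) j0 : j0 < m ->
  (forall j, j < m -> P j = (j == j0)) -> \sum_(j < m) P j = 1.
Proof.
move=> j0m PE; rewrite (bigD1 (Ordinal j0m)) //= PE // eqxx big1 // => j.
by rewrite -val_eqE /= PE // => /negPf->.
Qed.

Lemma sum_dvdn d g : 0 < d -> \sum_(i < d * g) (d %| i) = g.
Proof.
move=> d0; elim: g => [|g IHg]; first by rewrite muln0 big_ord0.
rewrite mulnSr big_split_ord /= IHg -[RHS]addn1; congr (_ + _).
rewrite (@sum_indicator_unique d (fun j => d %| d * g + j) 0) // => j jd.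
by rewrite dvdn_addr ?dvdn_mulr // /dvdn modn_small.
Qed.

Lemma sum_dvdn_mul a b : 0 < b -> \sum_(i < b) (b %| a * i) = gcdn a b.
Proof.
move=> b0; have g0 : 0 < gcdn a b by rewrite gcdn_gt0 b0 orbT.
set g := gcdn a b in g0 *; pose a' := a %/ g; pose b' := b %/ g.
have aE : a = a' * g by rewrite divnK // dvdn_gcdl.
have bE : b = b' * g by rewrite divnK // dvdn_gcdr.
have b'0 : 0 < b' by rewrite divn_gt0 // dvdn_leq // dvdn_gcdr.
have co : coprime b' a'.
  by rewrite coprime_sym /coprime -(eqn_pmul2r g0) mul1n muln_gcdl -aE -bE.
rewrite -[RHS](sum_dvdn g b'0) bE; apply: eq_bigr => i _.
by rewrite aE mulnAC dvdn_pmul2r // Gauss_dvdr.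
Qed.

(** For i < b, a solution j exists precisely if b divides a i, and then it is
    unique; such i are the gcd(a, b) multiples of b / gcd(a, b) below b. *)
Lemma count_lattice_points a b : 0 < b ->
  \sum_(i < b) \sum_(j < a.+1) (a * i + b * j == a * b) = gcdn a b.
Proof.
move=> b0; rewrite -sum_dvdn_mul //; apply: eq_bigr => i _.
have [/dvdnP[q qE]|ndvd] := boolP (b %| a * i).
  have qa : q <= a.
    by rewrite -(leq_pmul2r b0) -qE leq_mul2l (ltnW (ltn_ord i)) orbT.
  rewrite (@sum_indicator_unique _ (fun j => a * i + b * j == a * b) (a - q)).
  - by [].
  - by rewrite ltnS leq_subr.
  - move=> j _; rewrite qE (mulnC b) -mulnDl eqn_pmul2r //.
    by apply/eqP/eqP; lia.
rewrite big1 // => j _; case: eqP => // sE; case/negP: ndvd.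
by rewrite -(dvdn_addl _ (dvdn_mulr j (dvdnn b))) sE dvdn_mull.
Qed.

Lemma geometric_sum q s : 1 < q -> \sum_(i < s) q ^ i = (q ^ s - 1) %/ (q - 1).
Proof. by move=> q1; rewrite !subn1 predn_exp mulKn // -ltnS prednK // ltnW. Qed.

(** The two quotients are the geometric sums of X^(a i) for i < b and of X^(b j)
    for j <= a.  Their product is the generating polynomial of a i + b j, whose
    b (a + 1) terms are fewer than X = 2^(b (a + 1)). *)
Lemma gcd_digit a b (X := 2 ^ (b * a.+1)) : 0 < a -> 0 < b ->
  ((X ^ (a * b) - 1) %/ (X ^ a - 1) * ((X ^ (b * a.+1) - 1) %/ (X ^ b - 1)))
    %/ X ^ (a * b) %% X = gcdn a b.
Proof.
move=> a0 b0; have ba0 : 0 < b * a.+1 by rewrite muln_gt0 b0.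
have X1 : 1 < X by rewrite -(expn0 2) ltn_exp2l.
have pairsX : b * a.+1 < X by apply: ltn_expl.
clearbody X; rewrite 2!expnM -!geometric_sum; try by rewrite -(expn0 X) ltn_exp2l.
rewrite -expnM big_distrlr /= pair_big /=.
have -> : \sum_(p : 'I_b * 'I_a.+1) (X ^ a) ^ p.1 * (X ^ b) ^ p.2 =
    \sum_(p : 'I_b * 'I_a.+1) 1 * X ^ (a * p.1 + b * p.2).
  by apply: eq_bigr => p _; rewrite mul1n expnD !expnM.
rewrite digit_extraction; last by rewrite sum1_card card_prod !card_ord.
rewrite -count_lattice_points // pair_big /= big_mkcond /=.
by apply: eq_bigr => p _; case: eqP.
Qed.

Lemma two_part_gcd m : 0 < m -> gcdn m (2 ^ m) = 2 ^ logn 2 m.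
Proof.
move=> m0; set v := logn 2 m.
have vm : v <= m by rewrite ltnW // /v ltn_logl.
have [u co mE] := pfactor_coprime (isT : prime 2) m0.
have -> : 2 ^ m = 2 ^ (m - v) * 2 ^ v by rewrite -expnD subnK.
rewrite [X in gcdn X]mE -/v -muln_gcdl.
have /eqnP-> : coprime u (2 ^ (m - v)) by rewrite coprimeXr // coprime_sym.
exact: mul1n.
Qed.

(** The power on the left is 2^(v (m+1)) = (1 + Y)^v, which is 1 + v Y modulo
    Y^2, where v = logn 2 m; and 1 + v Y < Y^2 because v < m < Y. *)
Lemma log_two_part m (Y := 2 ^ m.+1 - 1) : 0 < m ->
  (gcdn m (2 ^ m) ^ m.+1 %% Y ^ 2) %/ Y = logn 2 m.
Proof.
move=> m0; rewrite two_part_gcd //; set v := logn 2 m.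
have vm : v < m by rewrite /v ltn_logl.
have mY : m < Y by have := ltn_expl m.+1 (isT : 1 < 2); rewrite /Y; lia.
have expE k : exists r, (Y + 1) ^ k = r * Y ^ 2 + (k * Y + 1).
  elim: k => [|k [r rE]]; first by exists 0.
  by exists (r * (Y + 1) + k); rewrite expnS rE; ring.
have [r rE] := expE v.
have -> : (2 ^ v) ^ m.+1 = (Y + 1) ^ v.
  by rewrite -expnM mulnC expnM /Y subnK ?expn_gt0.
rewrite rE modnMDl modn_small; last by nia.
by rewrite divnMDl ?divn_small ?addn0 //; lia.
Qed.

(** * Zeros of x y - n z - 1 in the cube *)

Lemma sum_quotient_unique n x y : 1 < n -> x <= n -> y <= n ->
  \sum_(z < n + 1) (x * y == n * z + 1) = (x * y %% n == 1).
Proof.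
move=> n1 xn yn; have [xy1|xy1] := eqVneq (x * y %% n) 1.
  have := divn_eq (x * y) n; rewrite xy1; set q := _ %/ _ => xyE.
  apply: (@sum_indicator_unique _ (fun z => x * y == n * z + 1) q) => [|z _].
    by have := leq_mul xn yn; nia.
  by rewrite xyE eqn_add2r mulnC eqn_pmul2l 1?eq_sym // ltnW.
rewrite big1 // => z _; case: eqP => // xyE; case/eqP: xy1.
by rewrite xyE mulnC modnMDl modn_small.
Qed.

(** Uniqueness of the inverse among y <= n uses that y = n never inverts x,
    which requires n > 1. *)
Lemma sum_inverse_unique n x : 1 < n ->
  \sum_(y < n + 1) (x * y %% n == 1) = coprime n x.
Proof.
move=> n1; have [co|nco] := boolP (coprime n x); last first.
  rewrite big1 // => y _; case: eqP => // xy1; case/negP: nco.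
  rewrite coprime_sym; apply: modn_coprime; last by exists y.
  by case: x xy1 => //; rewrite mul0n mod0n.
have x0 : 0 < x.
  by case: x co => //; rewrite /coprime gcdn0 => /eqP nE; rewrite nE in n1.
rewrite coprime_sym in co; have /(coprimeP n x0)[[u v] /= uvE] := co.
pose y0 := u %% n.
have y0n : y0 < n by rewrite ltn_mod ltnW.
have xy0 : x * y0 %% n = 1.
  have uE : x * u = v * n + 1 by lia.
  by rewrite modnMmr uE modnMDl modn_small.
apply: (@sum_indicator_unique _ (fun y => x * y %% n == 1) y0) => [|y yn].
  by lia.
apply/eqP/eqP => [xy1|-> //].
have yy0 : y %% n = y0.
  rewrite -(modn_small y0n) -[y in LHS]muln1 -xy0 modnMmr mulnCA mulnA.
  by rewrite -modnMml xy1 mul1n.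
have [yn'|] := ltnP y n; first by rewrite -yy0 modn_small.
move=> ny; have yE : y = n by lia.
by move: xy1; rewrite yE modnMl.
Qed.

(** Summing over z first tests whether y inverts x modulo n, then summing over y
    tests whether x is a unit.  The range goes up to x = n, which is not a unit
    since n > 1. *)
Lemma totient_count n : 1 < n ->
  \sum_(z < n + 1) \sum_(y < n + 1) \sum_(x < n + 1) (x * y == n * z + 1)
  = totient n.
Proof.
move=> n1; rewrite exchange_big /=.
under eq_bigr => y _ do rewrite exchange_big /=.
rewrite exchange_big /= totient_count_coprime big_mkord.
transitivity (\sum_(x < n + 1) coprime n x); last first.
  rewrite addn1 big_ord_recr /= [X in _ + X](_ : _ = 0) ?addn0 //.
  by rewrite /coprime gcdnn; case: eqP n1 => [->|].
apply: eq_bigr => x _; rewrite -sum_inverse_unique //; apply: eq_bigr => y _.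
by apply: sum_quotient_unique => //; rewrite -ltnS -(addn1 n) ltn_ord.
Qed.

(** * Digits of M *)

(** This is where the offset 5 in w = n + 5 comes from: the left-hand side
    bounds the values of (x y - n z - 1)^2 on the cube. *)
Lemma sqr_bound n : (n ^ 2 + 1) ^ 2 <= 2 ^ (n + 5).
Proof.
have [n6|] := ltnP n 6; first by do 6![case: n n6 => [|n] n6 //].
elim: n => // n IHn; rewrite leq_eqVlt => /orP[/eqP<- //|n6].
rewrite addSn [2 ^ _]expnS; apply: leq_trans _ (leq_mul (leqnn 2) (IHn n6)).
(* Beyond 6 doubling beats the growth of the quartic: with n = m + 6 the
   difference has nonnegative coefficients. *)
have [m ->] : exists m, n = m + 6 by exists (n - 6); lia.
have -> : 2 * ((m + 6) ^ 2 + 1) ^ 2 = ((m + 6).+1 ^ 2 + 1) ^ 2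
   + (m ^ 4 + 20 * m ^ 3 + 140 * m ^ 2 + 376 * m + 238) by ring.
exact: leq_addr.
Qed.

(** The square of x y - n z - 1; one of the two truncated differences is 0. *)
Definition defect n x y z := (x * y - (n * z + 1) + (n * z + 1 - x * y)) ^ 2.

Lemma defect_eq0 n x y z : (defect n x y z == 0) = (x * y == n * z + 1).
Proof. by rewrite expn_eq0 andbT; lia. Qed.

(** The expanded square, with its negative monomials moved to the left. *)
Lemma defect_expand n x y z :
  defect n x y z + 2 * n * (x * y * z) + 2 * (x * y) =
  x ^ 2 * y ^ 2 + n ^ 2 * z ^ 2 + 2 * n * z + 1.
Proof.
rewrite /defect; have [le|/ltnW le] := leqP (n * z + 1) (x * y).
  have -> : n * z + 1 - x * y = 0 by apply/eqP.
  by have := subnK le; rewrite addn0; set d := _ - _; nia.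
have -> : x * y - (n * z + 1) = 0 by apply/eqP.
by have := subnK le; rewrite add0n; set d := _ - _; nia.
Qed.

Lemma defect_le n x y z : x <= n -> y <= n -> z <= n ->
  defect n x y z <= 2 ^ (n + 5).
Proof.
move=> xn yn zn; apply: leq_trans (sqr_bound n); rewrite /defect leq_exp2r //.
have : x * y <= n * n by apply: leq_mul.
have : n * z <= n * n by apply: leq_mul.
rewrite -mulnn; lia.
Qed.

Definition digit n x y z :=
  (2 ^ (n + 5) - 1) * (2 ^ (n + 5) + 1 - defect n x y z).

Lemma digit_expand n x y z : x <= n -> y <= n -> z <= n ->
  digit n x y z
  + (2 ^ (n + 5) - 1) * (x ^ 2 * y ^ 2 + n ^ 2 * z ^ 2 + 2 * n * z) =
  (2 ^ (n + 5) - 1) * 2 ^ (n + 5)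
  + (2 ^ (n + 5) - 1) * (2 * n * (x * y * z) + 2 * (x * y)).
Proof.
move=> xn yn zn; rewrite /digit -!mulnDr; congr (_ * _).
have := defect_le xn yn zn; have := defect_expand n x y z.
lia.
Qed.

Lemma digit_lt n x y z : digit n x y z < 2 ^ (2 * (n + 5)).
Proof.
rewrite /digit [2 * _]mulnC expnM -mulnn; set p := 2 ^ (n + 5).
have p0 : 0 < p by rewrite expn_gt0.
apply: (@leq_ltn_trans ((p - 1) * (p + 1))).
  exact: leq_mul (leqnn _) (leq_subr _ _).
nia.
Qed.

(** A zero of the defect turns the digit into 2^(2w) - 1, doubling its weight. *)
Lemma HW_digit n x y z : x <= n -> y <= n -> z <= n ->
  HW (digit n x y z) = (n + 5) * (1 + (x * y == n * z + 1)).
Proof.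
move=> xn yn zn; rewrite /digit -defect_eq0.
have := defect_le xn yn zn; case: eqP => [->|/eqP d0] dle.
  by rewrite subn0 -subn_sqr exp1n -expnM HW_mersenne.
by rewrite HW_mersenne_mul ?addn0 ?muln1 //; apply/andP; split; lia.
Qed.

(** * Sums over the cube *)

Section Box.
Variables (t q0 q1 q2 : nat).

(** With q0 = q, q1 = q^t, q2 = q^(t^2), this is the number whose base-q digit
    of rank x + t y + t^2 z is F x y z.  Keeping the three bases separate makes
    the sum of a monomial factor over the coordinates. *)
Definition box (F : nat -> nat -> nat -> nat) :=
  \sum_(z < t) \sum_(y < t) \sum_(x < t) F x y z * (q0 ^ x * q1 ^ y * q2 ^ z).

Lemma eq_box F1 F2 :
  (forall x y z, x < t -> y < t -> z < t -> F1 x y z = F2 x y z) ->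
  box F1 = box F2.
Proof.
by move=> eqF; do 3![apply: eq_bigr => ? _]; rewrite eqF ?ltn_ord.
Qed.

Lemma box_add F1 F2 :
  box (fun x y z => F1 x y z + F2 x y z) = box F1 + box F2.
Proof.
rewrite /box -big_split; apply: eq_bigr => z _ /=.
rewrite -big_split; apply: eq_bigr => y _ /=.
by rewrite -big_split; apply: eq_bigr => x _ /=; rewrite mulnDl.
Qed.

Lemma box_scale a F : box (fun x y z => a * F x y z) = a * box F.
Proof.
rewrite /box big_distrr; apply: eq_bigr => z _ /=.
rewrite big_distrr; apply: eq_bigr => y _ /=.
by rewrite big_distrr; apply: eq_bigr => x _ /=; rewrite -[LHS]mulnA.
Qed.

(** Distributivity: a sum over the cube of a product of functions of one
    coordinate each. *)
Lemma box_monomial r0 r1 r2 : 0 < t ->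
  box (fun x y z => x ^ r0 * y ^ r1 * z ^ r2) =
  G r0 q0 (t - 1) * G r1 q1 (t - 1) * G r2 q2 (t - 1).
Proof.
move=> t0; rewrite /G subn1 prednK // !big_mkord [RHS]mulnC big_distrl /=.
apply: eq_bigr => z _; rewrite [X in _ * X]mulnC big_distrl big_distrr /=.
apply: eq_bigr => y _; rewrite big_distrr big_distrr /=.
by apply: eq_bigr => x _; lia.
Qed.

End Box.

(** Juxtaposition of digits, applied to lines, then planes, then the cube. *)
Lemma HW_box t W (F : nat -> nat -> nat -> nat) :
  (forall x y z, x < t -> y < t -> z < t -> F x y z < 2 ^ W) ->
  HW (box t (2 ^ W) (2 ^ (W * t)) (2 ^ (W * t ^ 2)) F) =
  \sum_(z < t) \sum_(y < t) \sum_(x < t) HW (F x y z).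
Proof.
move=> FW.
pose line y z := \sum_(x < t) F x y z * 2 ^ (W * x).
pose plane z := \sum_(y < t) line y z * 2 ^ (W * t * y).
have lineW y z : y < t -> z < t -> line y z < 2 ^ (W * t).
  move=> yt zt; apply: (digits_bound (d := fun x => F x y z)) => x xt.
  exact: FW.
have planeW z : z < t -> plane z < 2 ^ (W * t ^ 2).
  move=> zt; rewrite -mulnn mulnA.
  by apply: (digits_bound (d := line^~ z)) => y yt; apply: lineW.
have -> : box t (2 ^ W) (2 ^ (W * t)) (2 ^ (W * t ^ 2)) F =
    \sum_(z < t) plane z * 2 ^ (W * t ^ 2 * z).
  apply: eq_bigr => z _; rewrite /plane big_distrl; apply: eq_bigr => y _ /=.
  rewrite /line !big_distrl; apply: eq_bigr => x _ /=.
  by rewrite -!expnM !mulnA.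
rewrite HW_digits //; apply: eq_bigr => z _.
rewrite (HW_digits (d := line^~ z)) => [|y yt]; last exact: lineW.
apply: eq_bigr => y _; rewrite (HW_digits (d := fun x => F x y z)) // => x xt.
exact: FW.
Qed.

Lemma G0_geometric q s : (q - 1) * G 0 q s = q ^ s.+1 - 1.
Proof.
rewrite /G big_mkord !subn1 predn_exp; congr (_ * _).
by apply: eq_bigr => i _; rewrite mul1n.
Qed.

(** The number with all its t^3 digits equal to 1 is (q^(t^3) - 1) / (q - 1) for
    q = 2^(2w), and q - 1 = (2^w + 1) (2^w - 1); this is the role of the quotient
    in [Cterm]. *)
Lemma box_const_quotient t w : 0 < t ->
  2 ^ w * ((2 ^ (2 * w * t ^ 3) - 1) %/ (2 ^ w + 1)) =
  box t (2 ^ (2 * w)) (2 ^ (2 * w * t)) (2 ^ (2 * w * t ^ 2))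
    (fun _ _ _ => (2 ^ w - 1) * 2 ^ w).
Proof.
move=> t0; set q0 := 2 ^ (2 * w).
set q1 := 2 ^ (2 * w * t); set q2 := 2 ^ (2 * w * t ^ 2).
have geom q : (q - 1) * G 0 q (t - 1) = q ^ t - 1.
  by rewrite G0_geometric [t - 1]subn1 prednK.
have q0E : q0 - 1 = (2 ^ w + 1) * (2 ^ w - 1).
  by rewrite [RHS]mulnC -subn_sqr exp1n -expnM (mulnC w).
have powE : 2 ^ (2 * w * t ^ 3) - 1 =
    (2 ^ w + 1) * ((2 ^ w - 1) *
      (G 0 q0 (t - 1) * G 0 q1 (t - 1) * G 0 q2 (t - 1))).
  rewrite mulnA -q0E !mulnA geom -[q0 ^ t]expnM geom -[q1 ^ t]expnM.
  by rewrite -[2 * w * t * t]mulnA mulnn geom -expnM -mulnA -expnSr.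
rewrite powE mulKn ?addn1 // mulnA -box_monomial // -box_scale.
by apply: eq_box => x y z _ _ _; rewrite !expn0 !muln1 mulnC.
Qed.

(** * The digit expansion of M *)

Definition power_sum n r i :=
  G r (2 ^ (2 * (n + 5) * (n + 1) ^ i)) (n + 1 - 1).

(** The positive and negative contributions to [M n] are kept apart, so that
    truncated subtraction computes their difference. *)
Definition M_pos n :=
  2 ^ (n + 5) * ((2 ^ (2 * (n + 5) * (n + 1) ^ 3) - 1) %/ (2 ^ (n + 5) + 1))
  + (2 ^ (n + 5) - 1) *
    (2 * n * (power_sum n 1 0 * power_sum n 1 1 * power_sum n 1 2)
     + 2 * (power_sum n 1 0 * power_sum n 1 1 * power_sum n 0 2)).

Definition M_neg n :=
  (2 ^ (n + 5) - 1) *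
    (power_sum n 2 0 * power_sum n 2 1 * power_sum n 0 2
     + n ^ 2 * (power_sum n 0 0 * power_sum n 0 1 * power_sum n 2 2)
     + 2 * n * (power_sum n 0 0 * power_sum n 0 1 * power_sum n 1 2)).

Lemma Aterm_power_sum n alpha r0 r1 r2 :
  Aterm (n + 1) (n + 5) (pow_monomial alpha [tuple r0; r1; r2]) =
  (- (2 ^+ (n + 5) - 1) * alpha *
    (power_sum n r0 0 * power_sum n r1 1 * power_sum n r2 2)%N%:Z)%R.
Proof.
rewrite /Aterm !big_ord_recr big_ord0 /= !(tnth_nth 0) /= /power_sum.
by rewrite !muln1 mul1r !PoszM.
Qed.

Lemma M_posneg n : M n = ((M_pos n)%:Z - (M_neg n)%:Z)%R.
Proof.
have pow2 k : (2 ^+ k = (2 ^ k)%N%:Z :> int)%R.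
  by rewrite -[LHS]/((2%N%:R : int) ^+ k)%R -natrX natz.
rewrite /M !Aterm_power_sum /Cterm /M_pos /M_neg !pow2.
set p := 2 ^ (n + 5).
have p0 : 0 < p by rewrite expn_gt0.
set P := 2 ^ (2 * (n + 5) * (n + 1) ^ 3).
have P0 : 0 < P by rewrite expn_gt0.
have -> : (divz (P%:Z - 1) (p%:Z + 1) = ((P - 1) %/ (p + 1))%N%:Z)%R.
  by rewrite -divz_nat PoszD subzn.
set c := (P - 1) %/ (p + 1).
rewrite !(PoszM, PoszD) -subzn //.
ring.
Qed.

(** Termwise over the cube, this is [digit_expand]: each power sum product is the
    sum over the cube of one monomial. *)
Lemma box_digit n :
  box (n + 1) (2 ^ (2 * (n + 5))) (2 ^ (2 * (n + 5) * (n + 1)))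
    (2 ^ (2 * (n + 5) * (n + 1) ^ 2)) (digit n) + M_neg n = M_pos n.
Proof.
set w := n + 5; set t := n + 1.
have t0 : 0 < t by rewrite /t addn1.
set B := box t _ _ _.
have monoE r0 r1 r2 : power_sum n r0 0 * power_sum n r1 1 * power_sum n r2 2 =
    B (fun x y z => x ^ r0 * y ^ r1 * z ^ r2).
  by rewrite /power_sum expn0 expn1 muln1 /B box_monomial.
rewrite /M_neg /M_pos box_const_quotient // !monoE -/w -/t.
rewrite -!(box_scale, box_add); apply: eq_box => x y z xt yt zt.
rewrite /t addn1 !ltnS in xt yt zt.
by rewrite !expn0 !expn1 !muln1 !mul1n /w digit_expand.
Qed.

Lemma M_box n :
  M n = Posz (box (n + 1) (2 ^ (2 * (n + 5))) (2 ^ (2 * (n + 5) * (n + 1)))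
    (2 ^ (2 * (n + 5) * (n + 1) ^ 2)) (digit n)).
Proof. by rewrite M_posneg -box_digit PoszD addrK. Qed.

Lemma M_absz n : `|M n|%N = M_pos n - M_neg n.
Proof. by rewrite M_box absz_nat -box_digit addnK. Qed.

(** Each of the t^3 digits contributes w ones, and each zero w further ones. *)
Lemma HW_M n : 1 < n ->
  HW `|M n| = (n + 5) * ((n + 1) ^ 3 + totient n).
Proof.
move=> n1; rewrite M_box absz_nat HW_box; last by move=> *; apply: digit_lt.
transitivity (\sum_(z < n + 1) \sum_(y < n + 1) \sum_(x < n + 1)
    (n + 5) * (1 + (x * y == n * z + 1))).
  do 3![apply: eq_bigr => ? _].
  by apply: HW_digit; rewrite -ltnS -(addn1 n) ltn_ord.
under eq_bigr => z _ do under eq_bigr => y _ do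
  rewrite -big_distrr big_split /= sum1_card card_ord.
under eq_bigr => z _ do
  rewrite -big_distrr big_split /= sum_nat_const card_ord.
by rewrite -big_distrr big_split /= sum_nat_const card_ord totient_count.
Qed.

(** * Arithmetic terms *)

Lemma G_recr r q s : G r q s.+1 = G r q s + s.+1 ^ r * q ^ s.+1.
Proof. by rewrite /G big_nat_recr. Qed.

Lemma G_nat0 r q : G r q 0 = 0 ^ r.
Proof. by rewrite /G big_nat1 expn0 muln1. Qed.

(** Multiplication by q - 1 turns the sum of the j q^j for j <= s into
    s q^(s+1) minus the sum of the q^j for 1 <= j <= s. *)
Lemma G1_telescope q s : 0 < q -> (q - 1) * G 1 q s + G 0 q s = s * q ^ s.+1 + 1.
Proof.
case: q => // q _; rewrite subn1 /=.
elim: s => [|s IHs]; first by rewrite !G_nat0 muln0.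
rewrite !G_recr [q.+1 ^ s.+2]expnS; move: IHs; set p := _ ^ _; nia.
Qed.

(** As for exponent 1, with j^2 - (j-1)^2 = 2 j - 1 as the new coefficients. *)
Lemma G2_telescope q s : 0 < q ->
  (q - 1) * G 2 q s + (1 + 2 * G 1 q s) = s ^ 2 * q ^ s.+1 + G 0 q s.
Proof.
case: q => // q _; rewrite subn1 /=.
elim: s => [|s IHs]; first by rewrite !G_nat0 muln0.
rewrite !G_recr [q.+1 ^ s.+2]expnS; move: IHs; set p := _ ^ _; nia.
Qed.

Section ArithmeticTerms.
Variables (k : nat) (v : 'I_k -> nat).
Implicit Types a b q s : aterm k.

(** Half of (a + b)^2 - (a^2 + b^2). *)
Definition mulT a b :=
  ADiv (ASub (APow (AAdd a b) (ACst k 2))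
             (AAdd (APow a (ACst k 2)) (APow b (ACst k 2))))
       (ACst k 2).

Definition modT a b := ASub a (mulT (ADiv a b) b).

Definition predecT a := ASub a (ACst k 1).

Definition G0T q s :=
  ADiv (predecT (APow q (AAdd s (ACst k 1)))) (predecT q).

Definition G1T q s :=
  ADiv (ASub (AAdd (mulT s (APow q (AAdd s (ACst k 1)))) (ACst k 1)) (G0T q s))
       (predecT q).

Definition G2T q s :=
  ADiv (ASub (AAdd (mulT (APow s (ACst k 2)) (APow q (AAdd s (ACst k 1))))
                   (G0T q s))
             (AAdd (ACst k 1) (mulT (ACst k 2) (G1T q s))))
       (predecT q).

Definition binomialT a b :=
  let X := APow (ACst k 2) (AAdd a (ACst k 1)) in
  modT (ADiv (APow (AAdd X (ACst k 1)) a) (APow X b)) X.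

Definition gcdT a b :=
  let X := APow (ACst k 2) (mulT b (AAdd a (ACst k 1))) in
  modT (ADiv (mulT (ADiv (predecT (APow X (mulT a b))) (predecT (APow X a)))
                   (ADiv (predecT (APow X (mulT b (AAdd a (ACst k 1)))))
                         (predecT (APow X b))))
             (APow X (mulT a b))) X.

Definition valuation2T a :=
  let Y := predecT (APow (ACst k 2) (AAdd a (ACst k 1))) in
  ADiv (modT (APow (gcdT a (APow (ACst k 2) a)) (AAdd a (ACst k 1)))
             (APow Y (ACst k 2))) Y.

Definition HWT a := valuation2T (binomialT (mulT (ACst k 2) a) a).

Lemma eval_cst c : eval_aterm v (ACst k c) = c. Proof. by []. Qed.

Lemma eval_add a b : eval_aterm v (AAdd a b) = eval_aterm v a + eval_aterm v b.
Proof. by []. Qed.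

Lemma eval_sub a b : eval_aterm v (ASub a b) = eval_aterm v a - eval_aterm v b.
Proof. by []. Qed.

Lemma eval_div a b : eval_aterm v (ADiv a b) = eval_aterm v a %/ eval_aterm v b.
Proof. by []. Qed.

Lemma eval_pow a b : eval_aterm v (APow a b) = eval_aterm v a ^ eval_aterm v b.
Proof. by []. Qed.

Definition eval_simpl := (eval_cst, eval_add, eval_sub, eval_div, eval_pow).

Lemma eval_mul a b : eval_aterm v (mulT a b) = eval_aterm v a * eval_aterm v b.
Proof. by rewrite !eval_simpl sqrnD addKn mulKn. Qed.

Lemma eval_mod a b : eval_aterm v (modT a b) = eval_aterm v a %% eval_aterm v b.
Proof.
set m := eval_aterm v a; set d := eval_aterm v b.
by rewrite /modT eval_sub eval_mul eval_div -/m -/d {1}(divn_eq m d) addKn.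
Qed.

Lemma eval_G0 q s : 1 < eval_aterm v q ->
  eval_aterm v (G0T q s) = G 0 (eval_aterm v q) (eval_aterm v s).
Proof.
move=> q1; rewrite /G0T /predecT !eval_simpl addn1.
by rewrite -G0_geometric mulKn ?subn_gt0.
Qed.

Lemma eval_G1 q s : 1 < eval_aterm v q ->
  eval_aterm v (G1T q s) = G 1 (eval_aterm v q) (eval_aterm v s).
Proof.
move=> q1; rewrite /G1T /predecT.
rewrite !(eval_G0 s q1, eval_mul, eval_simpl) [_ s + 1]addn1.
by rewrite -G1_telescope ?addnK ?mulKn ?subn_gt0 // ltnW.
Qed.

Lemma eval_G2 q s : 1 < eval_aterm v q ->
  eval_aterm v (G2T q s) = G 2 (eval_aterm v q) (eval_aterm v s).
Proof.
move=> q1; rewrite /G2T /predecT.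
rewrite !(eval_G0 s q1, eval_G1 s q1, eval_mul, eval_simpl) [_ s + 1]addn1.
by rewrite -G2_telescope ?addnK ?mulKn ?subn_gt0 // ltnW.
Qed.

Lemma eval_binomial a b : eval_aterm v b <= eval_aterm v a ->
  eval_aterm v (binomialT a b) = 'C(eval_aterm v a, eval_aterm v b).
Proof.
move=> ba; rewrite /binomialT eval_mod !eval_simpl !addn1.
by rewrite -binomial_digit ?addn1.
Qed.

Lemma eval_gcd a b : 0 < eval_aterm v a -> 0 < eval_aterm v b ->
  eval_aterm v (gcdT a b) = gcdn (eval_aterm v a) (eval_aterm v b).
Proof.
move=> a0 b0; rewrite -gcd_digit // /gcdT /predecT.
by rewrite !(eval_mod, eval_mul, eval_simpl) addn1.
Qed.

Lemma eval_valuation2 a : 0 < eval_aterm v a ->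
  eval_aterm v (valuation2T a) = logn 2 (eval_aterm v a).
Proof.
move=> a0; have gcdE : eval_aterm v (gcdT a (APow (ACst k 2) a)) =
    gcdn (eval_aterm v a) (2 ^ eval_aterm v a).
  by rewrite eval_gcd // eval_pow expn_gt0.
rewrite -log_two_part // /valuation2T /predecT.
by rewrite eval_div eval_mod !(gcdE, eval_simpl) addn1.
Qed.

Lemma eval_HW a : eval_aterm v (HWT a) = HW (eval_aterm v a).
Proof.
have le2 : eval_aterm v a <= eval_aterm v (mulT (ACst k 2) a).
  by rewrite eval_mul leq_pmull.
rewrite HW_central_binomial /HWT eval_valuation2 eval_binomial //.
  by rewrite eval_mul.
by rewrite bin_gt0.
Qed.

End ArithmeticTerms.

(** * The term for the totient *)

Definition argT : aterm 1 := AVar ord0.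
Definition weightT := AAdd argT (ACst 1 5).
Definition sideT := AAdd argT (ACst 1 1).

Definition radixT i :=
  APow (ACst 1 2) (mulT (mulT (ACst 1 2) weightT) (APow sideT (ACst 1 i))).

(** Only the exponents 0, 1 and 2 occur in [M]; the last branch is meant for 2. *)
Definition power_sumT r i :=
  match r with
  | 0 => G0T (radixT i) (predecT sideT)
  | 1 => G1T (radixT i) (predecT sideT)
  | _ => G2T (radixT i) (predecT sideT)
  end.

Definition M_posT :=
  AAdd
    (mulT (APow (ACst 1 2) weightT)
          (ADiv (predecT (radixT 3)) (AAdd (APow (ACst 1 2) weightT) (ACst 1 1))))
    (mulT (predecT (APow (ACst 1 2) weightT))
      (AAdd
        (mulT (mulT (ACst 1 2) argT)
          (mulT (mulT (power_sumT 1 0) (power_sumT 1 1)) (power_sumT 1 2)))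
        (mulT (ACst 1 2)
          (mulT (mulT (power_sumT 1 0) (power_sumT 1 1)) (power_sumT 0 2))))).

Definition M_negT :=
  mulT (predecT (APow (ACst 1 2) weightT))
    (AAdd
      (AAdd
        (mulT (mulT (power_sumT 2 0) (power_sumT 2 1)) (power_sumT 0 2))
        (mulT (APow argT (ACst 1 2))
          (mulT (mulT (power_sumT 0 0) (power_sumT 0 1)) (power_sumT 2 2))))
      (mulT (mulT (ACst 1 2) argT)
        (mulT (mulT (power_sumT 0 0) (power_sumT 0 1)) (power_sumT 1 2)))).

Definition totientT :=
  ASub (ADiv (HWT (ASub M_posT M_negT)) weightT) (APow sideT (ACst 1 3)).

Section Evaluation.
Variable n : nat.
Local Notation ev := (eval_aterm (fun _ : 'I_1 => n)).

Lemma eval_radix i : ev (radixT i) = 2 ^ (2 * (n + 5) * (n + 1) ^ i).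
Proof. by rewrite /radixT !(eval_mul, eval_simpl). Qed.

Lemma eval_power_sum r i : r <= 2 -> ev (power_sumT r i) = power_sum n r i.
Proof.
have radix_gt1 : 1 < ev (radixT i).
  rewrite eval_radix -(expn0 2) ltn_exp2l //.
  by rewrite !muln_gt0 expn_gt0 !addn_gt0 !orbT.
case: r => [|[|[|//]]] _; rewrite /power_sumT.
- by rewrite eval_G0 // eval_radix.
- by rewrite eval_G1 // eval_radix.
by rewrite eval_G2 // eval_radix.
Qed.

Lemma eval_M : ev (ASub M_posT M_negT) = `|M n|%N.
Proof.
rewrite M_absz eval_sub /M_posT /M_negT /predecT.
by rewrite !(eval_power_sum, eval_radix, eval_mul, eval_simpl).
Qed.

Lemma eval_totient : 1 < n -> ev totientT = totient n.
Proof.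
move=> n1; rewrite /totientT eval_sub eval_div eval_HW.
rewrite eval_M HW_M //.
have -> : ev weightT = n + 5 by [].
have -> : ev (APow sideT (ACst 1 3)) = (n + 1) ^ 3 by [].
by rewrite mulKn ?addKn // addn_gt0 orbT.
Qed.

End Evaluation.

Theorem theorem6p3 :
  exists T : aterm 1,
    forall n : nat, (2 <= n)%N ->
      [/\ (0 <= M n)%R,
          ((eval_aterm (fun _ => n) T)%:R =
             (HW `|M n|%N)%:R / (n + 5)%:R - ((n + 1) ^ 3)%:R :> rat)%R
        & ((totient n)%:R =
             (HW `|M n|%N)%:R / (n + 5)%:R - ((n + 1) ^ 3)%:R :> rat)%R].
Proof.
exists totientT => n n2.
have totientE : ((totient n)%:R =
    (HW `|M n|%N)%:R / (n + 5)%:R - ((n + 1) ^ 3)%:R :> rat)%R.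
  have w0 : ((n + 5)%:R != 0 :> rat)%R by rewrite pnatr_eq0 addn_eq0 andbF.
  by rewrite HW_M // natrM mulrC mulKf // natrD [RHS]addrC addKr.
split=> //; first by rewrite M_box.
by rewrite eval_totient.
Qed.
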